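(* Let $f(\cdot,\xi)$ and $g(\cdot,\xi)$ be convex functions. Consider either the SPG method, where $g(\cdot,\xi)$ admits an easily computable proximal operator, or the SPP method, where $f(\cdot,\xi)$ and $g(\cdot,\xi)$ both admit easily computable proximal operators and in addition $g(\cdot,\xi)$ has bounded subgradients, i.e. there is $B_g>0$ with $\|\nabla g(x,\xi)\|\le B_g$ for all $x$ and $\xi$. Assume the stochastic bounded gradient condition: there are constants $L\ge 0$ and $B\ge 0$ such that $$B^2+L\,(F(x)-F(\overline{x}))\ \ge\ \mathbf{E}_{\xi}\left[\|\nabla F(x,\xi)\|^2\right]\qquad \forall x\in\operatorname{dom}F.$$ Additionally assume $L>0$, variable stepsize $\gamma_t=\gamma_0/\sqrt{t}$ for $t\ge1$ with $\gamma_0=1/L$, and that the distance of the iterates to the optimal set is bounded in the sense that $\mathbf{E}[\|x_t-\overline{x}_t\|^2]\le R^2$ for all $t\ge0$. Then the average of iterates $\hat{x}_t=\frac1t\sum_{j=0}^{t-1}x_j$ satisfies $$\mathbf{E}\left[F(\hat{x}_t)-F^*\right]\le\frac{1}{\sqrt{t}}\left(R^2L+\frac{2\mathcal{B}^2}{L}\right)\qquad\forall t\ge1.$$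
   Context: Problem: $f,g:\mathbb{R}^m\times\Omega\to\mathbb{R}\cup\{\pm\infty\}$ are proper and convex in the first argument, $\Omega$ carries a probability distribution $\mathbf{P}$, $\xi\in\Omega$ is a random variable with this distribution, $f(x)=\mathbf{E}[f(x,\xi)]$, $g(x)=\mathbf{E}[g(x,\xi)]$, $F(x,\xi)=f(x,\xi)+g(x,\xi)$, and $F(x)=f(x)+g(x)=\mathbf{E}[F(x,\xi)]$, with expectations finite for all $x\in\operatorname{dom}F$. One considers $F^*=\min_{x\in\mathbb{R}^m}F(x)$, with optimal set $X^*$; for $x\in\mathbb{R}^m$, $\overline{x}=\Pi_{X^*}(x)$ is the Euclidean projection of $x$ onto $X^*$ (so $\overline{x}_t=\Pi_{X^*}(x_t)$). (Sub)gradients are taken in the first argument: $\nabla f(x,\xi)\in\partial f(x,\xi)$, $\nabla g(x,\xi)\in\partial g(x,\xi)$, $\nabla F(x,\xi)=\nabla f(x,\xi)+\nabla g(x,\xi)$, where $\nabla f(x,\xi)$ denotes the gradient, or a subgradient if $f(\cdot,\xi)$ is not differentiable; they are unbiased, i.e. $\mathbf{E}[\nabla f(x,\xi)]\in\partial f(x)$. For a convex $h$ and $\gamma>0$, $\operatorname{prox}_{\gamma h}(x)=\arg\min_y h(y)+\frac{1}{2\gamma}\|y-x\|^2$. Algorithms: let $(\xi_t)_{t\ge0}$ be i.i.d. copies of $\xi$, $x_0\in\mathbb{R}^m$, and $(\gamma_t)_{t\ge 0}$ positive stepsizes. SPG (stochastic proximal gradient): $x_{t+1}=\operatorname{prox}_{\gamma_t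 g(\cdot,\xi_t)}(x_t-\gamma_t\nabla f(x_t,\xi_t))$. SPP (stochastic proximal point): $x_{t+1/2}=\operatorname{prox}_{\gamma_t f(\cdot,\xi_t)}(x_t)$, $x_{t+1}=\operatorname{prox}_{\gamma_t g(\cdot,\xi_t)}(x_{t+1/2})$. Notation: $\mathcal{B}^2=B^2$ for SPG and $\mathcal{B}^2=B^2+B_g^2$ for SPP.
   Formalization: The formal theorem additionally assumes that every iterate x_t (including x_0) lies in dom F almost surely; without this the claim fails, e.g. for x_0 outside dom F or for random constraint indicators g(.,ξ). *)

(* Defs.v *)
From HB Require Import structures.
From mathcomp Require Import all_boot all_order all_algebra.
From mathcomp Require Import all_classical all_reals all_analysis.
From mathcomp Require Import measurable_realfun.
Import Order.TTheory GRing.Theory Num.Theory.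
Import numFieldNormedType.Exports.

Set Implicit Arguments.
Unset Strict Implicit.
Unset Printing Implicit Defensive.

Local Open Scope classical_set_scope.
Local Open Scope ring_scope.

(* R^m is 'rV[R]_m; since the library norm on matrices is the sup norm, the
   Euclidean structure is defined here. *)
Section euclidean.
Context {R : realType} {m : nat}.
Implicit Types (u v x y : 'rV[R]_m) (A : set 'rV[R]_m).

Definition dotv u v : R := \sum_i u 0 i * v 0 i.

Definition enorm u : R := Num.sqrt (dotv u u).

(* The set of Euclidean projections of x onto A. *)
Definition eproj A x : set 'rV[R]_m :=
  [set y | A y /\ forall z, A z -> enorm (y - x) <= enorm (z - x)].

End euclidean.

(* R^m with its Borel sigma-algebra (matrices carry no measurable structure in
   the library). *)
Notation borel_rV R m := (g_sigma_algebraType (@open 'rV[R]_m)).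

Section extended_valued_functions.
Context {R : realType} {m : nat}.
Implicit Types (h : 'rV[R]_m -> \bar R) (x : 'rV[R]_m).

Definition edom h : set 'rV[R]_m := [set x | (h x < +oo)%E].

Definition proper_fun h : Prop :=
  (forall x, (-oo < h x)%E) /\ edom h !=set0.

(* The right-hand side is unambiguous for functions that never take the value
   -oo; this predicate is only used together with proper_fun. *)
Definition econvex h : Prop :=
  forall (x y : 'rV[R]_m) (l : R), 0 < l < 1 ->
    (h (l *: x + (1 - l) *: y)%R <= l%:E * h x + (1 - l)%R%:E * h y)%E.

(* For proper h this is empty at points outside the domain. *)
Definition subdiff h x : set 'rV[R]_m :=
  [set v | forall y, (h x + (dotv v (y - x)%R)%:E <= h y)%E].

Definition argmin h : set 'rV[R]_m := [set x | forall y, (h x <= h y)%E].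

Definition optval h : \bar R := ereal_inf (range h).

Definition prox (gamma : R) h x : set 'rV[R]_m :=
  argmin (fun y => (h y + ((2 * gamma)^-1 * enorm (y - x) ^+ 2)%R%:E)%E).

End extended_valued_functions.

Section stochastic.
Context {R : realType} {m : nat}.
Context {d : measure_display} {Omega : measurableType d}.
Variable P : probability Omega R.
Implicit Types (f g : 'rV[R]_m -> Omega -> \bar R).
Implicit Types (gf : 'rV[R]_m -> Omega -> 'rV[R]_m).

Definition jointly_measurable_ereal f : Prop :=
  measurable_fun setT (fun z : borel_rV R m * Omega => f z.1 z.2).

Definition jointly_measurable_rV gf : Prop :=
  measurable_fun setT
    (fun z : borel_rV R m * Omega => (gf z.1 z.2 : borel_rV R m)).

Definition Efun f : 'rV[R]_m -> \bar R := fun x => (\int[P]_w f x w)%E.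

Definition objective f g : 'rV[R]_m -> \bar R :=
  fun x => (Efun f x + Efun g x)%E.

Definition integrable_rV (v : Omega -> 'rV[R]_m) : Prop :=
  forall i, P.-integrable setT (fun w => (v w 0 i)%:E).

Definition mean_rV (v : Omega -> 'rV[R]_m) : 'rV[R]_m :=
  \row_i \int[P]_w (v w 0 i).

(* gf is a measurable selection x, w |-> gf x w of subgradients of f(., w), and
   its mean is a subgradient of the averaged function; D is the set of points x
   at which this is required.  Off D the values of gf are irrelevant. *)
Definition subgradient_oracle (D : set 'rV[R]_m) f gf : Prop :=
  [/\ jointly_measurable_rV gf,
      forall x, D x -> {ae P, forall w, subdiff (f ^~ w) x (gf x w)},
      forall x, D x -> integrable_rV (gf x) &
      forall x, D x -> subdiff (Efun f) x (mean_rV (gf x))].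

(* pf gamma x w is the proximal point of x for gamma * f(., w).  When the
   minimizer exists it is unique by strong convexity. *)
Definition prox_operator f (pf : R -> 'rV[R]_m -> Omega -> 'rV[R]_m) : Prop :=
  forall gamma, 0 < gamma ->
    (forall x w, prox gamma (f ^~ w) x (pf gamma x w)) /\
    jointly_measurable_rV (pf gamma).

Section sampling.
Context {d' : measure_display} {S : measurableType d'} {Pr : probability S R}.
Variable xi : nat -> {RV Pr >-> Omega}.

Definition mutually_independent : Prop :=
  forall (J : seq nat) (A : nat -> set Omega),
    uniq J -> (forall i, measurable (A i)) ->
    Pr (\bigcap_(i in [set` J]) (xi i @^-1` A i)) =
    (\prod_(i <- J) Pr (xi i @^-1` A i))%E.

Definition iid_copies : Prop :=
  mutually_independent /\
  forall t (A : set Omega), measurable A -> distribution Pr (xi t) A = P A.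

Variables (gamma : nat -> R) (x0 : 'rV[R]_m).

Definition SPG_iterates gf (pg : R -> 'rV[R]_m -> Omega -> 'rV[R]_m)
    (x : nat -> S -> 'rV[R]_m) : Prop :=
  (forall s, x 0%N s = x0) /\
  forall t s, x t.+1 s =
    pg (gamma t) (x t s - gamma t *: gf (x t s) (xi t s)) (xi t s).

Definition SPP_iterates (pf pg : R -> 'rV[R]_m -> Omega -> 'rV[R]_m)
    (x : nat -> S -> 'rV[R]_m) : Prop :=
  (forall s, x 0%N s = x0) /\
  forall t s, x t.+1 s =
    pg (gamma t) (pf (gamma t) (x t s) (xi t s)) (xi t s).

End sampling.
End stochastic.

Definition average {R : realType} {m : nat} {S : Type}
    (x : nat -> S -> 'rV[R]_m) (t : nat) : S -> 'rV[R]_m :=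
  fun s => t%:R^-1 *: \sum_(0 <= j < t) x j s.

(* Main.v *)
Require Import Defs.
From HB Require Import structures.
From mathcomp Require Import all_boot all_order all_algebra.
From mathcomp Require Import all_classical all_reals all_analysis.
From mathcomp Require Import measurable_realfun ring lra.
Import Order.TTheory GRing.Theory Num.Theory.
Import numFieldNormedType.Exports.

Local Open Scope classical_set_scope.
Local Open Scope ring_scope.

(** Write r(y) for the squared distance from y to the set X* of minimizers,
    gap(y) for F(y) - F*, and C for 0 (gradient method) or Bg^2 (proximal point
    method).  Both methods have the form x_{t+1} = Phi_t(x_t, xi_t), and the
    proof rests on one inequality: for a fixed y in the domain of F,

      E_w[r(Phi_t(y, w))] + gamma_t gap(y) <= r(y) + gamma_t^2 (B^2 + C).

    Pathwise, the proximal subproblems are strongly convex, so each minimizer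
    satisfies a three-point inequality (prox_three_point).  The function values
    at the new points are moved back to y with the subgradients at y, and the
    remaining cross terms are absorbed by completing the square
    (spg_step, spp_step).  This gives, for a minimizer z,

      |z - Phi_t(y, w)|^2 + 2 gamma_t (F(y, w) - F(z, w))
        <= |z - y|^2 + gamma_t^2 (|grad F(y, w)|^2 + C).

    Taking z to be the projection of y, integrating over w, and applying the
    bounded gradient condition costs gamma_t^2 L gap(y), which is at most
    gamma_t gap(y) because gamma_t L <= 1; half of the decrease survives
    (expected_descent).

    The iterate x_t depends on the samples before t only, so the joint law of
    (x_t, xi_t) is the product of the law of x_t and P
    (law_current_sample), and Tonelli turns the inequality for fixed y
    into one for E[r(x_t)] and E[gap(x_t)] (expected_step).  All the quantities
    compared are integrals of nonnegative functions.  The projection enters the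
    expectations through r only, and r is measurable because {r < c} is open,
    being the union over z in X* of the balls {y | |z - y|^2 < c}.

    Finally, dividing by gamma_t and summing by parts with E[r(x_t)] <= R^2
    bounds the sum of the E[gap(x_j)], j < t, by
    R^2 / gamma_{t-1} + (B^2 + C) sum_{j<t} gamma_j (telescoping_bound).  The
    first term is at most R^2 L sqrt t, the second at most
    2 (B^2 + C) sqrt t / L, and Jensen's inequality for the average of the
    iterates concludes. *)

(** * Euclidean geometry and the deterministic step inequalities *)

Section euclidean_inequalities.
Context {R : realType} {m : nat}.
Implicit Types (u v w x y z p q : 'rV[R]_m) (h : 'rV[R]_m -> \bar R).

Lemma dotvDl u v w : dotv (u + v) w = dotv u w + dotv v w.
Proof. by rewrite -big_split; apply: eq_bigr => i _; rewrite mxE mulrDl. Qed.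

Lemma dotvC u v : dotv u v = dotv v u.
Proof. by apply: eq_bigr => i _; rewrite mulrC. Qed.

Lemma dotvZl a u v : dotv (a *: u) v = a * dotv u v.
Proof. by rewrite mulr_sumr; apply: eq_bigr => i _; rewrite mxE mulrA. Qed.

Lemma dotvNl u v : dotv (- u) v = - dotv u v.
Proof. by rewrite -scaleN1r dotvZl mulN1r. Qed.

Lemma dotvDr u v w : dotv w (u + v) = dotv w u + dotv w v.
Proof. by rewrite dotvC dotvDl !(dotvC w). Qed.

Lemma dotvZr a u v : dotv v (a *: u) = a * dotv v u.
Proof. by rewrite dotvC dotvZl dotvC. Qed.

Lemma dotvNr u v : dotv v (- u) = - dotv v u.
Proof. by rewrite dotvC dotvNl dotvC. Qed.

Definition dotvE := (dotvDl, dotvDr, dotvZl, dotvZr, dotvNl, dotvNr).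

Lemma dotvv_ge0 u : 0 <= dotv u u.
Proof. by apply: sumr_ge0 => i _; rewrite -expr2 sqr_ge0. Qed.

Lemma enorm_sqr u : enorm u ^+ 2 = dotv u u.
Proof. by rewrite sqr_sqrtr // dotvv_ge0. Qed.

Lemma enorm_ge0 u : 0 <= enorm u.
Proof. exact: sqrtr_ge0. Qed.

Lemma enormB u v : enorm (u - v) = enorm (v - u).
Proof. by rewrite /enorm -(opprB v u) dotvNl dotvNr opprK. Qed.

Lemma subdiff_fine h x v y : subdiff h x v -> h x \is a fin_num ->
  h y \is a fin_num -> fine (h x) + dotv v (y - x) <= fine (h y).
Proof.
by move=> /(_ y) hxy /fineK hxE /fineK hyE; rewrite -lee_fin EFinD hxE hyE.
Qed.

Lemma prox_fin_num h gamma x p : proper_fun h -> prox gamma h x p ->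
  h p \is a fin_num.
Proof.
move=> [hN [y hy]] hp; rewrite fin_numE gt_eqF ?hN //= lt_eqF //.
rewrite ltNge leye_eq; apply/eqP => hpE.
have := hp y; rewrite /= hpE.
by move: hy; rewrite /edom /=; case: (h y).
Qed.

(** The proximal objective is strongly convex, hence exceeds its minimum value
    at z by a multiple of |z - p|^2.  Minimality of p is tested on the segment
    from p to z at parameter l; this gives the inequality with a factor 1 - l,
    and l is then sent to 0. *)
Lemma prox_three_point h gamma x p z : 0 < gamma -> proper_fun h ->
    econvex h -> prox gamma h x p -> h z \is a fin_num ->
  2 * gamma * (fine (h p) - fine (h z)) + enorm (p - x) ^+ 2 +
    enorm (z - p) ^+ 2 <= enorm (z - x) ^+ 2.
Proof.
move=> g0 hproper hconv hp hz.
have hpf := prox_fin_num _ _ _ _ hproper hp.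
move: (hz) (hpf) => /fineK; move: (fine (h z)) => b bE.
move=> /fineK; move: (fine (h p)) => a aE; rewrite !enorm_sqr.
suff key l : 0 < l < 1 -> 2 * gamma * (a - b) + dotv (p - x) (p - x) +
    (1 - l) * dotv (z - p) (z - p) <= dotv (z - x) (z - x).
  (* This parameter makes the defect l * |z - p|^2 at most e. *)
  apply/ler_addgt0Pr => e e0; have d0 := dotvv_ge0 (z - p).
  set d := dotv (z - p) (z - p) in d0 key *.
  have den : 0 < d + e + 1 by lra.
  have := key (e / (d + e + 1)).
  have q0 : 0 < e / (d + e + 1) by rewrite divr_gt0.
  have q1 : e / (d + e + 1) < 1 by rewrite ltr_pdivrMr //; lra.
  have qd : e / (d + e + 1) * d <= e.
    by rewrite mulrAC ler_pdivrMr //; nra.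
  by rewrite q0 q1 => /(_ isT); rewrite mulrBl mul1r; lra.
move=> l01; have /andP[l0 l1] := l01.
have := hp (l *: z + (1 - l) *: p)%R; rewrite /= -aE.
have := hconv z p l l01; rewrite /= -aE -bE -!EFinM -EFinD.
case: (h (l *: z + (1 - l) *: p)%R) => [r| |] //=.
rewrite -?EFinD !lee_fin !enorm_sqr => h1 h2.
have c0 : 0 < (2 * gamma)^-1 by rewrite invr_gt0 mulr_gt0.
have cE : 2 * gamma * (2 * gamma)^-1 = 1 by rewrite mulfV //; lra.
move: c0 cE h2; move: (2 * gamma)^-1 => c c0 cE h2.
have E1 : dotv (l *: z + (1 - l) *: p - x) (l *: z + (1 - l) *: p - x) =
  l * dotv (z - x) (z - x) + (1 - l) * dotv (p - x) (p - x) -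
  l * (1 - l) * dotv (z - p) (z - p).
  rewrite !dotvE (dotvC p z) (dotvC x z) (dotvC x p); ring.
rewrite E1 in h2.
move: h2; set A := dotv (z - x) _; set Bq := dotv (p - x) _.
set D := dotv (z - p) _ => h2.
have : l * (a - b + c * (Bq + (1 - l) * D - A)) <= 0.
  have -> : l * (a - b + c * (Bq + (1 - l) * D - A)) =
    (a + c * Bq) - (l * b + (1 - l) * a +
      c * (l * A + (1 - l) * Bq - l * (1 - l) * D)) by ring.
  by lra.
rewrite pmulr_rle0 // => h3.
have -> : 2 * gamma * (a - b) + Bq + (1 - l) * D =
  2 * gamma * (a - b + c * (Bq + (1 - l) * D - A)) +
  (1 - 2 * gamma * c) * (Bq + (1 - l) * D - A) + A by ring.
rewrite cE subrr mul0r addr0 gerDr pmulr_rle0 //; lra.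
Qed.

(** The three-point inequality at the shifted centre y - gamma u already
    contains the linearization of f at y; what is left over is
    - |p - y|^2 - 2 gamma <u + w, p - y>, at most gamma^2 |u + w|^2. *)
Lemma spg_step gamma u w y z p (fy fz gy gz gp : R) : 0 < gamma ->
  fy + dotv u (z - y) <= fz -> gy + dotv w (p - y) <= gp ->
  2 * gamma * (gp - gz) + enorm (p - (y - gamma *: u)) ^+ 2 +
    enorm (z - p) ^+ 2 <= enorm (z - (y - gamma *: u)) ^+ 2 ->
  enorm (z - p) ^+ 2 + 2 * gamma * (fy + gy - fz - gz) <=
    enorm (z - y) ^+ 2 + gamma ^+ 2 * enorm (u + w) ^+ 2.
Proof.
move=> g0 hf hg; rewrite !enorm_sqr => h3.
have h4 := dotvv_ge0 (p - y + gamma *: (u + w)).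
have h5 : 2 * gamma *
    (fy + dotv u (z - y) - fz + (gy + dotv w (p - y) - gp)) <= 0.
  by rewrite pmulr_rle0 ?mulr_gt0 //; lra.
move: h3 h4 h5; rewrite !dotvE !opprK.
rewrite (dotvC y u) (dotvC p u) (dotvC z u) (dotvC y w) (dotvC p w) (dotvC w u).
rewrite (dotvC y z) (dotvC y p) (dotvC p z).
lra.
Qed.

(** Two three-point inequalities are chained through the half step q.  The
    subgradient w of g is split along p - y = (q - y) + (p - q): the first
    increment pairs with u + w, and the second costs the extra
    gamma^2 Bg^2. *)
Lemma spp_step gamma Bg u w y z q p (fy fz fq gy gz gp : R) : 0 < gamma ->
  enorm w <= Bg ->
  fy + dotv u (q - y) <= fq -> gy + dotv w (p - y) <= gp ->
  2 * gamma * (fq - fz) + enorm (q - y) ^+ 2 + enorm (z - q) ^+ 2 <=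
    enorm (z - y) ^+ 2 ->
  2 * gamma * (gp - gz) + enorm (p - q) ^+ 2 + enorm (z - p) ^+ 2 <=
    enorm (z - q) ^+ 2 ->
  enorm (z - p) ^+ 2 + 2 * gamma * (fy + gy - fz - gz) <=
    enorm (z - y) ^+ 2 + gamma ^+ 2 * (enorm (u + w) ^+ 2 + Bg ^+ 2).
Proof.
move=> g0 wB hf hg h1 h2.
have wB2 : gamma ^+ 2 * dotv w w <= gamma ^+ 2 * Bg ^+ 2.
  apply: ler_wpM2l; first exact: sqr_ge0.
  rewrite -enorm_sqr ler_sqr // nnegrE ?enorm_ge0 //.
  exact: le_trans (enorm_ge0 w) wB.
have h4 := dotvv_ge0 (q - y + gamma *: (u + w)).
have h6 := dotvv_ge0 (p - q + gamma *: w).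
have h5 : 2 * gamma *
    (fy + dotv u (q - y) - fq + (gy + dotv w (p - y) - gp)) <= 0.
  by rewrite pmulr_rle0 ?mulr_gt0 //; lra.
have dB2 : dotv (u + w) (u + w) = enorm (u + w) ^+ 2 by rewrite enorm_sqr.
move: h1 h2 wB2 h4 h5 h6 dB2; rewrite mulrDr.
rewrite !enorm_sqr !dotvE !opprK.
rewrite ?(dotvC y u) ?(dotvC p u) ?(dotvC z u) ?(dotvC y w).
rewrite ?(dotvC p w) ?(dotvC w u).
rewrite ?(dotvC y z) ?(dotvC y p) ?(dotvC p z) ?(dotvC q z).
rewrite ?(dotvC q p) ?(dotvC y q).
rewrite ?(dotvC q u) ?(dotvC q w).
lra.
Qed.

End euclidean_inequalities.

(** * Borel measurability in R^m *)

Section borel_measurability.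
Context {R : realType} {m : nat}.
Implicit Types (A : set 'rV[R]_m) (h : 'rV[R]_m -> R).

Lemma open_measurable_rV A : open A -> measurable (A : set (borel_rV R m)).
Proof. exact: sub_sigma_algebra. Qed.

Lemma measurable_fun_usc h : (forall c, open [set v | h v < c]) ->
  measurable_fun setT (h : borel_rV R m -> R).
Proof.
move=> hopen; apply: (measurability _ (RGenInftyO.measurableE R)).
move=> _ [_ [c ->] <-]; rewrite setTI.
by apply: open_measurable_rV; rewrite preimage_itvNyo; exact: hopen.
Qed.

Lemma measurable_coord i : measurable_fun setT (fun v : borel_rV R m => v 0 i).
Proof.
apply: (measurable_fun_usc (fun v => v 0 i)) => c.
have := @coord_continuous R 1 m 0 i.
by move/continuousP => /(_ _ (open_lt (y := c))).
Qed.

Context {d : measure_display} {T : measurableType d}.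
Implicit Types (X Y : T -> 'rV[R]_m).

(** Rational boxes form a countable base, so measurability of a vector-valued
    map can be tested on its coordinates. *)
Lemma open_bigcup_ball A : open A ->
  A = \bigcup_(k : 'rV[rat]_m * nat)
    [set v | ball (map_mx ratr k.1 : 'rV[R]_m) k.2.+1%:R^-1 v /\
             ball (map_mx ratr k.1 : 'rV[R]_m) k.2.+1%:R^-1 `<=` A].
Proof.
move=> Aopen; apply/seteqP; split => [v Av|v [k _ [+ ]]]; last first.
  by move=> vk /(_ _ vk).
have [e /= e0 eA] : exists2 e : R, 0 < e & ball v e `<=` A.
  by apply/nbhs_ballP; apply: open_nbhs_nbhs.
have e20 : 0 < e / 2 by rewrite divr_gt0.
have [n ne] : exists n : nat, n.+1%:R^-1 < e / 2.
  have := @archi_boundP R (e / 2)^-1; rewrite invr_ge0 ltW // => /(_ isT).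
  set n := Num.bound _ => hn; exists n.
  rewrite -[ltRHS]invrK ltf_pV2 ?posrE ?invr_gt0 //.
  by rewrite (lt_trans hn) // ltr_nat.
have n0 : 0 < n.+1%:R^-1 :> R by rewrite invr_gt0.
have qP i : exists q : rat,
    ratr q \in `](v 0 i - n.+1%:R^-1 : R), (v 0 i + n.+1%:R^-1)[.
  by apply: rat_in_itvoo; move: n.+1%:R^-1 n0 => r r0; lra.
have {}qP i : {q : rat |
    ratr q \in `](v 0 i - n.+1%:R^-1 : R), (v 0 i + n.+1%:R^-1)[}.
  exact/cid/qP.
have kv : ball (map_mx ratr (\row_i sval (qP i)) : 'rV[R]_m) n.+1%:R^-1 v.
  split => // i j; rewrite !mxE ord1 -ball_normE /=.
  case: (qP j) => q /=; rewrite in_itv /= => /andP[].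
  move: n.+1%:R^-1 => r qj1 qj2.
  by rewrite ltr_norml; apply/andP; split; lra.
exists (\row_i sval (qP i), n) => //=; split => //.
move=> w kw; apply: eA; rewrite (splitr e).
apply: (@ball_triangle _ _ (map_mx ratr (\row_i sval (qP i)) : 'rV[R]_m)).
  by apply: ball_sym; apply: le_ball kv; exact: ltW.
by apply: le_ball kw; exact: ltW.
Qed.

Lemma measurable_fun_rV X :
  (forall i, measurable_fun setT (fun s => X s 0 i)) ->
  measurable_fun setT (X : T -> borel_rV R m).
Proof.
move=> mX.
apply: (@measurability _ _ T (borel_rV R m) setT X (@open 'rV[R]_m)) => //.
move=> _ [A Aopen <-]; rewrite setTI (open_bigcup_ball _ Aopen) preimage_bigcup.
apply: countable_bigcupT_measurable => [|[q n]]; first exact: countableP.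
rewrite /=; have [qA|qA] := pselect
    (ball (map_mx ratr q : 'rV[R]_m) n.+1%:R^-1 `<=` A); last first.
  by rewrite (_ : _ @^-1` _ = set0) //; apply/seteqP; split => // s [].
rewrite (_ : _ @^-1` _ = \bigcap_i
    ((fun s => X s 0 i) @^-1` ball (ratr (q 0 i) : R) n.+1%:R^-1)).
  apply: fin_bigcap_measurable => [|i _]; first exact: finite_finset.
  by rewrite -[X in measurable X]setTI; apply: mX => //; exact: measurable_ball.
apply/seteqP; split => s /=.
  by move=> -[[_ +] _] i _ => /(_ 0 i); rewrite mxE.
move=> sX; split => //; split; first by rewrite invr_gt0.
by move=> i j; rewrite mxE ord1; exact: (sX j I).
Qed.

Lemma measurable_rVP X : measurable_fun setT (X : T -> borel_rV R m) ->
  forall i, measurable_fun setT (fun s => X s 0 i).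
Proof. by move=> mX i; exact: (measurableT_comp (measurable_coord i) mX). Qed.

Lemma measurable_addrV X Y : measurable_fun setT (X : T -> borel_rV R m) ->
  measurable_fun setT (Y : T -> borel_rV R m) ->
  measurable_fun setT ((fun s => X s + Y s) : T -> borel_rV R m).
Proof.
move=> mX mY; apply: measurable_fun_rV => i; under eq_fun do rewrite mxE.
by apply: measurable_funD; exact: measurable_rVP.
Qed.

Lemma measurable_scalerV a X : measurable_fun setT (X : T -> borel_rV R m) ->
  measurable_fun setT ((fun s => a *: X s) : T -> borel_rV R m).
Proof.
move=> mX; apply: measurable_fun_rV => i; under eq_fun do rewrite mxE.
by apply: measurable_funM => //; exact: measurable_rVP.
Qed.

Lemma measurable_sumrV (Z : nat -> T -> 'rV[R]_m) n :
  (forall j, measurable_fun setT (Z j : T -> borel_rV R m)) ->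
  measurable_fun setT ((fun s => \sum_(0 <= j < n) Z j s) : T -> borel_rV R m).
Proof.
move=> mZ; apply: measurable_fun_rV => i; under eq_fun do rewrite summxE.
by apply: measurable_sum => j; exact: measurable_rVP.
Qed.

Lemma measurable_enorm_sqr X : measurable_fun setT (X : T -> borel_rV R m) ->
  measurable_fun setT (fun s => enorm (X s) ^+ 2).
Proof.
move=> mX; under eq_fun do rewrite enorm_sqr.
by apply: measurable_sum => i; apply: measurable_funM; exact: measurable_rVP.
Qed.

(** The strict sublevel sets of the squared distance to A are unions of open
    balls centred in A. *)
Lemma measurable_dist_sqr A (xbar : 'rV[R]_m -> 'rV[R]_m) :
  (forall y, eproj A y (xbar y)) ->
  measurable_fun setT (fun y : borel_rV R m => enorm (y - xbar y) ^+ 2).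
Proof.
move=> xbarP; apply: (measurable_fun_usc (fun y => enorm (y - xbar y) ^+ 2)).
move=> c; rewrite (_ : [set _ | _] =
    \bigcup_(z in A) [set y : 'rV[R]_m | dotv (z - y) (z - y) < c]).
  apply: bigcup_open => z _.
  have zi i : continuous (fun v : 'rV[R]_m => (z - v) 0 i).
    rewrite (_ : (fun v => _) = (fun v : 'rV[R]_m => z 0 i - v 0 i)).
      move=> v; pose nv : set_system 'rV[R]_m := nbhs v.
      have Fv : Filter nv by exact: nbhs_filter.
      have c1 : (fun w : 'rV[R]_m => w 0 i) @ nv --> (v 0 i : R).
        exact: (@coord_continuous R 1 m 0 i v).
      exact: (cvgB (cvg_cst (z 0 i)) c1).
    by apply/funext => w; rewrite !mxE.
  have zc : continuous (fun y : 'rV[R]_m => dotv (z - y) (z - y)).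
    apply: continuous_big => [|i _ y]; first exact: add_continuous.
    pose ny : set_system 'rV[R]_m := nbhs y.
    have Fy : Filter ny by exact: nbhs_filter.
    have c1 : (fun w : 'rV[R]_m => (z - w) 0 i) @ ny --> ((z - y) 0 i : R).
      exact: zi.
    exact: (cvgM c1 c1).
  by move/continuousP: zc => /(_ _ (open_lt (y := c))).
apply/seteqP; split => [y yc|y [z Az yc]] /=.
  have [Ay _] := xbarP y; exists (xbar y) => //=.
  by rewrite -enorm_sqr enormB.
rewrite enormB; apply: le_lt_trans yc; rewrite -enorm_sqr.
have [_ /(_ z Az) yz] := xbarP y.
by rewrite ler_sqr ?nnegrE ?enorm_ge0.
Qed.

Lemma jointly_measurable_rV_section (K : 'rV[R]_m -> T -> 'rV[R]_m) y :
  jointly_measurable_rV K -> measurable_fun setT (K y : T -> borel_rV R m).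
Proof. by move=> mK; exact: (measurable_fun_pair2 (y : borel_rV R m) mK). Qed.

Lemma jointly_measurable_rV_comp (K Y : 'rV[R]_m -> T -> 'rV[R]_m) :
  jointly_measurable_rV K -> jointly_measurable_rV Y ->
  jointly_measurable_rV (fun y w => K (Y y w) w).
Proof.
move=> mK mY; exact: (measurableT_comp mK (measurable_fun_pair mY
  (measurable_snd : measurable_fun setT (@snd (borel_rV R m) T)))).
Qed.

End borel_measurability.

(** * Independence of the current sample from the past *)

Section independence_from_future_samples.
Context {R : realType} {d d' : measure_display}.
Context {Omega : measurableType d} {P : probability Omega R}.
Context {S : measurableType d'} {Pr : probability S R}.
Variable xi : nat -> {RV Pr >-> Omega}.
Hypothesis xi_iid : iid_copies P xi.

Definition sample_event (J : seq nat) (A : nat -> set Omega) : set S :=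
  \bigcap_(i in [set` J]) (xi i @^-1` A i).

(** Independence of X from the samples of index at least t, tested on finite
    cylinders.  Keeping a whole cylinder of future samples in the statement,
    rather than the single sample xi t, makes it stable under the recursion
    X' = h(X, xi t), where t becomes t + 1. *)
Definition indep_of_future {d1} {T : measurableType d1} (t : nat)
    (X : S -> T) : Prop :=
  forall (C : set T) (J : seq nat) (A : nat -> set Omega), measurable C ->
    uniq J -> (forall i, i \in J -> (t <= i)%N) ->
    (forall i, measurable (A i)) ->
    Pr (X @^-1` C `&` sample_event J A) =
    (Pr (X @^-1` C) * Pr (sample_event J A))%E.

Lemma measurable_preimageT d1 d2 (T1 : measurableType d1)
    (T2 : measurableType d2) (X : T1 -> T2) (C : set T2) :
  measurable_fun setT X -> measurable C -> measurable (X @^-1` C).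
Proof. by move=> mX mC; rewrite -[X in measurable X]setTI; exact: mX. Qed.

Lemma measurable_sample_event J A : (forall i, measurable (A i)) ->
  measurable (sample_event J A).
Proof.
move=> mA; apply: fin_bigcap_measurable => [|i _]; first exact: finite_seq.
exact: measurable_preimageT.
Qed.

Lemma sample_event1 t B : sample_event [:: t] (fun=> B) = xi t @^-1` B.
Proof.
apply/seteqP; split => s /=; first by apply; rewrite /= inE.
by move=> Bs i /=; rewrite inE => /eqP ->.
Qed.

Lemma prob_sample t B : measurable B -> Pr (xi t @^-1` B) = P B.
Proof. by case: xi_iid => _; apply. Qed.

Lemma indep_of_future_cst d1 (T : measurableType d1) (x0 : T) :
  indep_of_future 0 (cst x0 : S -> T).
Proof.
move=> C J A mC _ _ mA; rewrite preimage_cst; case: ifPn => _.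
  by rewrite setTI probability_setT mul1e.
by rewrite set0I measure0 mul0e.
Qed.

Lemma indep_of_future_comp d1 d2 (T1 : measurableType d1)
    (T2 : measurableType d2) t (X : S -> T1) (h : T1 -> T2) :
  measurable_fun setT h -> indep_of_future t X ->
  indep_of_future t (h \o X).
Proof.
move=> mh Xt C J A mC uJ tJ mA; rewrite comp_preimage.
by apply: Xt => //; exact: measurable_preimageT.
Qed.

Context {d1 : measure_display} {T : measurableType d1}.
Variables (t : nat) (X : {RV Pr >-> T}).
Hypothesis Xt : indep_of_future t X.

Let mXxi : measurable_fun setT (fun s => (X s, xi t s)).
Proof. exact: measurable_fun_pair. Qed.

Lemma prob_current_sample A B : measurable A -> measurable B ->
  Pr (X @^-1` A `&` xi t @^-1` B) = (Pr (X @^-1` A) * P B)%E.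
Proof.
move=> mA mB; rewrite -(prob_sample t) // -sample_event1 Xt //.
by move=> i; rewrite inE => /eqP ->.
Qed.

Lemma law_current_sample (C : set (T * Omega)) : measurable C ->
  (distribution Pr X \x P)%E C = Pr ((fun s => (X s, xi t s)) @^-1` C).
Proof.
move=> mC; apply: (@product_measure_unique _ _ _ _ _ (distribution Pr X) P
  (pushforward Pr (fun s => (X s, xi t s)))) => //.
by move=> A B mA mB; exact: prob_current_sample.
Qed.

(** Freezing the past: the current sample may be averaged out first, with the
    iterate treated as a constant. *)
Lemma integral_current_sample (h : T * Omega -> \bar R) :
  measurable_fun setT h -> (forall z, (0 <= h z)%E) ->
  (\int[Pr]_s h (X s, xi t s) = \int[Pr]_s \int[P]_w h (X s, w))%E.
Proof.
move=> mh h0; pose Z : {mfun S >-> (T * Omega)%type} := mfun_Sub (mem_set mXxi).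
transitivity (\int[distribution Pr Z]_z h z)%E.
  by rewrite ge0_integral_distribution.
rewrite (eq_measure_integral (distribution Pr X \x P)%E); last first.
  by move=> A mA _; exact/esym/law_current_sample.
rewrite fubini_tonelli1 // ge0_integral_distribution //.
- exact: measurable_fun_fubini_tonelli_F.
- by move=> y; apply: integral_ge0.
Qed.

(** For a fixed cylinder event E, the two measures
    C |-> Pr((X, xi t) in C and E) and C |-> Pr((X, xi t) in C) Pr(E) agree on
    rectangles, where xi t in B merely enlarges the cylinder; rectangles form
    a pi-system generating the product sigma-algebra. *)
Lemma indep_of_future_pair :
  indep_of_future t.+1 (fun s => (X s, xi t s)).
Proof.
move=> C J A mC uJ tJ mA; have mJA := measurable_sample_event J A mA.
have c0 : 0 <= fine (Pr (sample_event J A)) by rewrite fine_ge0.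
have cE : (fine (Pr (sample_event J A)))%:E = Pr (sample_event J A).
  by rewrite fineK // fin_num_measure.
pose c := NngNum c0.
pose Z : {mfun S >-> (T * Omega)%type} := mfun_Sub (mem_set mXxi).
transitivity (mscale c (distribution Pr Z) C); last first.
  by rewrite /mscale /= cE muleC.
apply: (measure_unique
  [set A1 `*` B1 | A1 in measurable & B1 in measurable] (fun=> setT) _ _ _ _
  (pushforward (mrestr Pr mJA) Z) (mscale c (distribution Pr Z))) => //.
- exact: measurable_prod_measurableType.
- move=> _ _ [A1 mA1 [B1 mB1 <-]] [A2 mA2 [B2 mB2 <-]].
  exists (A1 `&` A2); first exact: measurableI.
  by exists (B1 `&` B2); [exact: measurableI|rewrite -setXI].
- by move=> _; exists setT => //; exists setT => //; rewrite setXTT.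
- by rewrite bigcup_const //; exists 0%N.
- move=> _ [A1 mA1 [B1 mB1 <-]]; transitivity
    (Pr (Z @^-1` (A1 `*` B1)) * Pr (sample_event J A))%E; last first.
    by rewrite -cE muleC.
  pose A' i := if i == t then B1 else A i.
  have mA' i : measurable (A' i) by rewrite /A'; case: ifP.
  have tNJ : t \notin J by apply/negP => /tJ; rewrite ltnn.
  have JA' : sample_event (t :: J) A' = xi t @^-1` B1 `&` sample_event J A.
    apply/seteqP; split => s /= => [tJs|[ts Js]].
      split; first by have := tJs t (mem_head _ _); rewrite /A' /= eqxx.
      move=> i /= iJ; have := tJs i; rewrite /= inE iJ orbT => /(_ isT).
      by rewrite /A' ifN //; apply: contraNneq tNJ => <-.
    move=> i /=; rewrite inE /A'; case: eqP => [-> _ //|_ /=]; exact: Js.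
  have utJ : uniq (t :: J) by rewrite /= tNJ.
  transitivity (Pr (X @^-1` A1 `&` sample_event (t :: J) A')).
    by rewrite JA' setIA.
  rewrite Xt //; last by move=> i; rewrite inE => /predU1P[->|/tJ/ltnW].
  have -> : Pr (Z @^-1` (A1 `*` B1)) = (Pr (X @^-1` A1) * P B1)%E.
    exact: prob_current_sample.
  rewrite -muleA; congr (_ * _)%E.
  case: (xi_iid) => mi _; rewrite /sample_event !mi // big_cons.
  rewrite {1}/A' eqxx prob_sample //; congr (_ * _)%E.
  apply: eq_big_seq => i iJ; rewrite /A' ifN //.
  by apply: contraNneq tNJ => <-.
- move=> _; apply: (@le_lt_trans _ _ 1%E); last exact: ltry.
  by apply: probability_le1; apply: measurableI => //;
    exact: (measurable_preimageT _ _ _ _ _ _ mXxi).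
Qed.

End independence_from_future_samples.

(** * The averaged objective *)

Section integral_monotonicity.
Context {R : realType} {d : measure_display} {T : measurableType d}.
Context {mu : measure T R}.

(** The positive and negative parts are compared separately, so the integrals
    may be infinite.  This is what makes it applicable at a point that is not
    yet known to lie in the domain of F. *)
Lemma le_integral_measurable (h k : T -> \bar R) :
  measurable_fun setT h -> measurable_fun setT k ->
  (forall w, (h w <= k w)%E) -> (\int[mu]_w h w <= \int[mu]_w k w)%E.
Proof.
move=> mh mk hk; rewrite [leLHS]integralE [leRHS]integralE; apply: leeB.
- apply: ge0_le_integral => //; try exact: measurable_funepos.
  by move=> w _; apply: (@funepos_le _ _ setT) => //; exact: in_setT.
- apply: ge0_le_integral => //; try exact: measurable_funeneg.
  by move=> w _; apply: (@funeneg_le _ _ setT) => //; exact: in_setT.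
Qed.

Lemma ae_ge0_le_integral_measurable (h k : T -> \bar R) :
  measurable_fun setT h -> measurable_fun setT k -> (forall w, 0 <= h w)%E ->
  {ae mu, forall w, (h w <= k w)%E} -> (\int[mu]_w h w <= \int[mu]_w k w)%E.
Proof.
move=> mh mk h0 hk; have mk' := measurable_funepos mk.
rewrite (ae_eq_integral k^\+%E k) //.
  apply: ae_ge0_le_integral => //.
  apply: filterS hk => w hkw _; apply: le_trans hkw _.
  by rewrite funeposE le_max lexx.
apply: filterS hk => w hkw _.
by rewrite funeposE max_l // (le_trans _ hkw).
Qed.

End integral_monotonicity.

Section averaged_objective.
Context {R : realType} {m : nat} {d : measure_display}.
Context {Omega : measurableType d} {P : probability Omega R}.
Implicit Types (x y z : 'rV[R]_m) (f g : 'rV[R]_m -> Omega -> \bar R).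

(** Efun is a difference of two Tonelli integrals. *)
Lemma measurable_Efun f : jointly_measurable_ereal f ->
  measurable_fun setT (Efun P f : borel_rV R m -> \bar R).
Proof.
move=> mf; rewrite (_ : Efun P f = fun y =>
    (fubini_F P (fun z : borel_rV R m * Omega => f z.1 z.2)^\+%E y -
     fubini_F P (fun z : borel_rV R m * Omega => f z.1 z.2)^\-%E y)%E).
  apply: emeasurable_funB; apply: measurable_fun_fubini_tonelli_F => //.
  - exact: measurable_funepos.
  - exact: measurable_funeneg.
apply/funext => y; rewrite /Efun integralE /fubini_F.
by congr (_ - _)%E; apply: eq_integral => w _; rewrite ?funeposE ?funenegE.
Qed.

Lemma jointly_measurable_section f y : jointly_measurable_ereal f ->
  measurable_fun setT (f y).
Proof. by move=> mf; exact: (measurable_fun_pair2 (y : borel_rV R m) mf). Qed.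

Lemma Efun_convex f x y (l : R) : jointly_measurable_ereal f ->
  (forall w, econvex (f ^~ w)) -> 0 < l < 1 ->
  P.-integrable setT (f x) -> P.-integrable setT (f y) ->
  (Efun P f (l *: x + (1 - l) *: y)%R <=
    l%:E * Efun P f x + (1 - l)%R%:E * Efun P f y)%E.
Proof.
move=> mf cf l01 fx fy.
rewrite /Efun -integralZl // -integralZl // -integralD //;
  try exact: integrableZl.
apply: le_integral_measurable.
- exact: jointly_measurable_section.
- by apply: emeasurable_funD; apply: emeasurable_funM => //;
    exact: jointly_measurable_section.
- by move=> w; exact: cf.
Qed.

Context {f g : 'rV[R]_m -> Omega -> \bar R}.
Local Notation F := (objective P f g).
Hypothesis f_meas : jointly_measurable_ereal f.
Hypothesis g_meas : jointly_measurable_ereal g.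
Hypothesis f_convex : forall w, econvex (f ^~ w).
Hypothesis g_convex : forall w, econvex (g ^~ w).
Hypothesis fg_finite : forall y, edom F y ->
  P.-integrable setT (f y) /\ P.-integrable setT (g y).

Lemma measurable_objective : measurable_fun setT (F : borel_rV R m -> \bar R).
Proof. by apply: emeasurable_funD; exact: measurable_Efun. Qed.

Lemma Efun_fin_num y : edom F y ->
  Efun P f y \is a fin_num /\ Efun P g y \is a fin_num.
Proof. by move=> /fg_finite[fy gy]; split; exact: integrable_fin_num. Qed.

Lemma objective_fin_num y : edom F y -> F y \is a fin_num.
Proof. by move=> /Efun_fin_num[fy gy]; rewrite fin_numD fy. Qed.

(** A point with F(y) = -oo would lie in the domain, where both integrals are
    finite. *)
Lemma objective_gtNy y : (-oo < F y)%E.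
Proof.
have [yF|] := pselect (edom F y).
  by have /fin_numP[] := objective_fin_num _ yF; rewrite ltNye.
by rewrite /edom /= => /negP; rewrite -leNgt; exact: lt_le_trans.
Qed.

(** Between two points of the domain the convexity inequality for each
    integral comes from integrating the pathwise one; if an endpoint is outside
    the domain, the right-hand side is +oo, as F is never -oo. *)
Lemma objective_convex : econvex F.
Proof.
move=> x y l l01; have /andP[l0 l1] := l01.
have l1' : 0 < 1 - l by rewrite subr_gt0.
have gtNy (a : R) z : 0 < a -> (-oo < a%:E * F z)%E.
  by move=> a0; rewrite -(gt0_muleNy (x := a%:E)) // lte_pmul2l //
    objective_gtNy.
have [xF|] := pselect (edom F x); last first.
  rewrite /edom /= => /negP; rewrite -leNgt leye_eq => /eqP ->.
  by rewrite gt0_muley // addye ?leey // -ltNye gtNy.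
have [yF|] := pselect (edom F y); last first.
  rewrite /edom /= => /negP; rewrite -leNgt leye_eq => /eqP ->.
  by rewrite [in leRHS]gt0_muley // addey ?leey // -ltNye gtNy.
have [fx gx] := fg_finite _ xF; have [fy gy] := fg_finite _ yF.
have := leeD (Efun_convex f x y l f_meas f_convex l01 fx fy)
             (Efun_convex g x y l g_meas g_convex l01 gx gy).
rewrite -/(F _) => /le_trans; apply.
rewrite /objective; have [/fineK <- /fineK <-] := Efun_fin_num _ xF.
have [/fineK <- /fineK <-] := Efun_fin_num _ yF.
by rewrite -!(EFinM, EFinD) lee_fin; nra.
Qed.

End averaged_objective.

Section convexity.
Context {R : realType} {m : nat}.
Implicit Types (h : 'rV[R]_m -> \bar R) (v : nat -> 'rV[R]_m).

Lemma optval_argmin h z : argmin h z -> optval h = h z.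
Proof.
move=> hz; apply/eqP; rewrite eq_le; apply/andP; split.
  by apply: ereal_inf_lbound; exists z.
by apply: le_ereal_inf_tmp => _ [y _ <-]; exact: hz.
Qed.

Lemma econvex_subr h (c : R) : (forall y, -oo < h y)%E -> econvex h ->
  econvex (fun y => h y - c%:E)%E.
Proof.
move=> hN hc x y l l01; have /andP[l0 l1] := l01.
have l1' : 0 < 1 - l by rewrite subr_gt0.
have := hc x y l l01.
case: (h x) (hN x) => [a| |] // _; case: (h y) (hN y) => [b| |] // _ hxy.
- case: (h _) hxy => [r| |]; rewrite -!(EFinM, EFinD) ?leye_eq ?leNye //.
  by rewrite !lee_fin; nra.
- by rewrite addye // gt0_muley // addey ?leey.
- by rewrite addye // gt0_muley // addye ?leey.
- by rewrite !addye // !gt0_muley // addye ?leey.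
Qed.

(** Jensen's inequality for a uniform average, by merging the last point with
    weight 1 / t.+2 at each step. *)
Lemma econvex_average h v t : (forall y, 0 <= h y)%E -> econvex h ->
  (0 < t)%N ->
  (h (t%:R^-1 *: \sum_(0 <= j < t) v j) <=
    t%:R^-1%:E * \sum_(0 <= j < t) h (v j))%E.
Proof.
move=> h0 hc; elim: t => // -[_ _|t ih _].
  by rewrite !big_nat1 invr1 scale1r mul1e.
rewrite big_nat_recr //= [in leRHS]big_nat_recr //=.
have t0 : 0 < t.+1%:R :> R by rewrite ltr0n.
have t1 : 0 < t.+2%:R :> R by rewrite ltr0n.
have tE : t.+2%:R = t.+1%:R + 1 :> R by rewrite -addn1 natrD.
pose l : R := t.+1%:R / t.+2%:R.
have l01 : 0 < l < 1.
  by rewrite divr_gt0 //= ltr_pdivrMr // mul1r tE ltrDl.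
have lE : 1 - l = t.+2%:R^-1.
  have d1 : t.+2%:R - t.+1%:R = 1 :> R by rewrite tE addrAC subrr add0r.
  by rewrite /l -[X in X - _](mulfV (lt0r_neq0 t1)) -mulrBl d1 mul1r.
have lM : t.+2%:R^-1 = l * t.+1%:R^-1.
  by rewrite /l mulrAC mulfV ?mul1r // gt_eqF.
rewrite scalerDr {1}lM -scalerA -lE.
apply: le_trans (hc _ _ _ l01) _; rewrite lE ge0_muleDr ?sume_ge0 //.
rewrite leeD2r //= [in leRHS]lM (EFinM l) -muleA lee_pmul2l //.
  exact: ih.
by rewrite lte_fin; case/andP: l01.
Qed.

End convexity.

(** * Step sizes and telescoping *)

Section step_sizes.
Context {R : realType}.

(** Summation by parts: after division by gamma j, the coefficient of a j in
    the sum is, for j > 0, the nonnegative number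
    1 / gamma j - 1 / gamma (j - 1), so a j can be replaced by its bound r and
    the coefficients telescope. *)
Lemma telescoping_bound (a e gamma : nat -> R) (r K : R) t :
  (forall j, 0 <= a j <= r) -> (forall j, 0 < gamma j) ->
  (forall j, gamma j.+1 <= gamma j) ->
  (forall j, a j.+1 + gamma j * e j <= a j + gamma j ^+ 2 * K) ->
  (0 < t)%N ->
  \sum_(0 <= j < t) e j <=
    r / gamma t.-1 + K * \sum_(0 <= j < t) gamma j.
Proof.
move=> ar g0 gdecr step; case: t => // t _ /=.
have ig j : 0 < (gamma j)^-1 by rewrite invr_gt0.
have e_le j : e j <= (a j - a j.+1) / gamma j + K * gamma j.
  rewrite -(ler_pM2l (g0 j)) mulrDr mulrCA mulfV ?gt_eqF // mulr1.
  have := step j; lra.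
(* The induction needs the term in a t.+1 that the conclusion drops. *)
suff : \sum_(0 <= j < t.+1) e j <=
    (r - a t.+1) / gamma t + K * \sum_(0 <= j < t.+1) gamma j.
  move=> /le_trans; apply; rewrite lerD2r ler_pM2r //.
  by have /andP[] := ar t.+1; lra.
elim: t => [|t ih].
  rewrite !big_nat1; apply: le_trans (e_le 0%N) _.
  by rewrite lerD2r ler_pM2r // lerD2r; case/andP: (ar 0%N).
rewrite !(big_nat_recr t.+1) //= mulrDr.
apply: le_trans (lerD ih (e_le t.+1)) _.
have : (r - a t.+1) / gamma t <= (r - a t.+1) / gamma t.+1.
  apply: ler_wpM2l; first by case/andP: (ar t.+1); lra.
  by rewrite lef_pV2 ?posrE.
by rewrite !mulrBl; lra.
Qed.

Lemma sqrt_increment (n : nat) :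
  (Num.sqrt n.+1%:R)^-1 <= 2 * (Num.sqrt n.+1%:R - Num.sqrt n%:R) :> R.
Proof.
have p0 : 0 < Num.sqrt n.+1%:R :> R by rewrite sqrtr_gt0 ltr0n.
have pE : Num.sqrt n.+1%:R ^+ 2 = Num.sqrt n%:R ^+ 2 + 1 :> R.
  by rewrite !sqr_sqrtr ?ler0n // -addn1 natrD.
rewrite -(ler_pM2l p0) mulfV ?gt_eqF //.
move: pE; set p := Num.sqrt n.+1%:R; set q := Num.sqrt n%:R => pE.
have := sqr_ge0 (p - q); nra.
Qed.

Variables (L : R) (gamma : nat -> R).
Hypothesis L_gt0 : 0 < L.
Hypothesis gamma_0 : gamma 0%N = L^-1.
Hypothesis gamma_t : forall t : nat, (1 <= t)%N ->
  gamma t = gamma 0%N / Num.sqrt (t%:R : R).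

Lemma step_size_gt0 t : 0 < gamma t.
Proof.
case: t => [|t]; first by rewrite gamma_0 invr_gt0.
by rewrite gamma_t // gamma_0 divr_gt0 ?invr_gt0 // sqrtr_gt0 ltr0n.
Qed.

Lemma step_size_nincr t : gamma t.+1 <= gamma t.
Proof.
have L0 : 0 < L^-1 by rewrite invr_gt0.
case: t => [|t]; first by rewrite gamma_t // sqrtr1 divr1.
rewrite (gamma_t t.+2) // (gamma_t t.+1) // gamma_0 ler_pM2l //.
rewrite lef_pV2 ?posrE ?sqrtr_gt0 ?ltr0n //.
by rewrite ler_sqrt ?ler0n // ler_nat.
Qed.

Lemma step_size_le t : gamma t * L <= 1.
Proof.
suff : gamma t <= L^-1 by rewrite -ler_pdivlMr // div1r.
by elim: t => [|t /(le_trans (step_size_nincr t))//]; rewrite gamma_0.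
Qed.

Lemma inv_step_size_le t : (0 < t)%N -> (gamma t.-1)^-1 <= L * Num.sqrt t%:R.
Proof.
case: t => // -[_|t _]; first by rewrite /= gamma_0 invrK sqrtr1 mulr1.
rewrite [t.+2.-1]/= gamma_t // gamma_0 invfM !invrK ler_pM2l //.
by rewrite ler_sqrt ?ler0n // ler_nat.
Qed.

(** The stronger bound 2 sqrt(t - 1) / L holds for t at least 2, since
    gamma 0 = gamma 1 = 1 / L; this slack is what the induction on
    sqrt_increment requires. *)
Lemma step_size_sum_le t :
  (0 < t)%N -> \sum_(0 <= j < t) gamma j <= 2 * Num.sqrt t%:R / L.
Proof.
have L0 : 0 < L^-1 by rewrite invr_gt0.
case: t => // -[_|t _].
  by rewrite big_nat1 sqrtr1 gamma_0 mulr1; lra.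
apply: (@le_trans _ _ (2 * Num.sqrt t.+1%:R / L)); last first.
  by rewrite ler_pM2r // ler_pM2l ?ltr0n // ler_sqrt ?ler0n // ler_nat.
elim: t => [|t ih].
  rewrite big_nat_recr //= big_nat1 (gamma_t 1%N) // sqrtr1 gamma_0; lra.
rewrite big_nat_recr //= gamma_t // gamma_0.
apply: le_trans (lerD ih (lexx _)) _.
have := ler_wpM2l (ltW L0) (sqrt_increment t.+1).
move: (Num.sqrt t.+1%:R) (Num.sqrt t.+2%:R) (Num.sqrt t.+2%:R)^-1 => q p ip.
lra.
Qed.

Lemma step_size_rate (r K : R) t : 0 <= r -> 0 <= K -> (0 < t)%N ->
  t%:R^-1 * (r / gamma t.-1 + K * \sum_(0 <= j < t) gamma j) <=
  (Num.sqrt t%:R)^-1 * (r * L + 2 * K / L).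
Proof.
move=> r0 K0 t0; have s0 : 0 < Num.sqrt t%:R :> R by rewrite sqrtr_gt0 ltr0n.
have tE : t%:R^-1 = (Num.sqrt t%:R)^-1 * (Num.sqrt t%:R)^-1 :> R.
  by rewrite -invfM -expr2 sqr_sqrtr ?ler0n.
rewrite tE -(mulrA _ _ (_ + _)).
rewrite (ler_pM2l (_ : 0 < (Num.sqrt t%:R)^-1)) ?invr_gt0 //.
rewrite mulrC ler_pdivrMr //.
have h1 := ler_wpM2l r0 (inv_step_size_le _ t0).
have h2 := ler_wpM2l K0 (step_size_sum_le _ t0).
apply: le_trans (lerD h1 h2) _; rewrite le_eqVlt; apply/orP; left; apply/eqP.
ring.
Qed.

End step_sizes.

(** * Expected descent of a stochastic splitting method *)

Section splitting_method.
Context {R : realType} {m : nat} {d d' : measure_display}.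
Context {Omega : measurableType d} {P : probability Omega R}.
Context {S : measurableType d'} {Pr : probability S R}.
Variable xi : nat -> {RV Pr >-> Omega}.
Hypothesis xi_iid : iid_copies P xi.

Variables (f g : 'rV[R]_m -> Omega -> \bar R).
Variables (gf gg : 'rV[R]_m -> Omega -> 'rV[R]_m) (xbar : 'rV[R]_m -> 'rV[R]_m).
Local Notation F := (objective P f g).
Hypothesis f_meas : jointly_measurable_ereal f.
Hypothesis g_meas : jointly_measurable_ereal g.
Hypothesis f_convex : forall w, econvex (f ^~ w).
Hypothesis g_convex : forall w, econvex (g ^~ w).
Hypothesis fg_finite : forall y, edom F y ->
  P.-integrable setT (f y) /\ P.-integrable setT (g y).
Hypothesis gf_meas : jointly_measurable_rV gf.
Hypothesis gg_meas : jointly_measurable_rV gg.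
Hypothesis xbar_proj : forall y, eproj (argmin F) y (xbar y).
Hypothesis F_dom : edom F !=set0.

Let gap (y : 'rV[R]_m) : \bar R := (F y - optval F)%E.
Let dist2 (y : 'rV[R]_m) : R := enorm (y - xbar y) ^+ 2.

Let xbar_argmin y : argmin F (xbar y). Proof. by case: (xbar_proj y). Qed.

Let xbar_dom y : edom F (xbar y).
Proof. by case: F_dom => z; apply: le_lt_trans; exact: xbar_argmin. Qed.

Let optvalE y : optval F = F (xbar y).
Proof. exact/optval_argmin/xbar_argmin. Qed.

Let optval_fin_num : optval F \is a fin_num.
Proof. by rewrite (optvalE 0); exact: objective_fin_num. Qed.

Let gap_ge0 y : (0 <= gap y)%E.
Proof. by rewrite /gap sube_ge0 ?optval_fin_num // (optvalE y) xbar_argmin. Qed.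

Let gap_fin_num y : edom F y -> gap y \is a fin_num.
Proof. by move=> yF; rewrite fin_numB objective_fin_num. Qed.

Let measurable_gap :
  measurable_fun setT (gap : borel_rV R m -> \bar R).
Proof. by apply: emeasurable_funB => //; exact: measurable_objective. Qed.

Let gap_convex : econvex gap.
Proof.
rewrite /gap -(fineK optval_fin_num); apply: econvex_subr.
  exact: objective_gtNy.
exact: objective_convex.
Qed.

Let measurable_dist2 : measurable_fun setT (dist2 : borel_rV R m -> R).
Proof. exact: measurable_dist_sqr xbar_proj. Qed.

Let dist2_ge0 y : 0 <= dist2 y. Proof. exact: sqr_ge0. Qed.

Variables (L B C : R).
Hypothesis C_ge0 : 0 <= C.
Hypothesis bounded_gradient : forall y, edom F y ->
  (\int[P]_w (enorm (gf y w + gg y w) ^+ 2)%R%:E <=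
    (B ^+ 2)%R%:E + L%:E * (F y - F (xbar y)))%E.

(** The pathwise inequality shared by the two methods, the constant C being the
    price of a second proximal step. *)
Definition descent_step (gamma : R) (Phi : 'rV[R]_m -> Omega -> 'rV[R]_m) :=
  forall y z, edom F y -> edom F z -> {ae P, forall w,
    enorm (z - Phi y w) ^+ 2 + 2 * gamma *
      (fine (f y w) + fine (g y w) - fine (f z w) - fine (g z w)) <=
    enorm (z - y) ^+ 2 + gamma ^+ 2 * (enorm (gf y w + gg y w) ^+ 2 + C)}.

Section one_step.
Variables (gamma : R) (Phi : 'rV[R]_m -> Omega -> 'rV[R]_m).
Hypothesis gamma_gt0 : 0 < gamma.
Hypothesis gammaL : gamma * L <= 1.
Hypothesis Phi_meas : jointly_measurable_rV Phi.
Hypothesis Phi_step : descent_step gamma Phi.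

Let measurable_dist2_step : measurable_fun setT
  (fun z : borel_rV R m * Omega => (dist2 (Phi z.1 z.2))%:E).
Proof.
by apply/measurable_EFinP; exact: (measurableT_comp measurable_dist2 Phi_meas).
Qed.

(** The pathwise inequality at the projection z of y is integrated over w.  The
    point z is fixed, and r(Phi y w) is at most |z - Phi y w|^2 because z is a
    minimizer. *)
Lemma expected_descent y : edom F y ->
  (\int[P]_w (dist2 (Phi y w))%:E + gamma%:E * gap y <=
    (dist2 y + gamma ^+ 2 * (B ^+ 2 + C))%:E)%E.
Proof.
move=> yF; have [fy gy] := fg_finite _ yF.
pose z := xbar y; have zF : edom F z := xbar_dom y.
have [fz gz] := fg_finite _ zF.
pose N w := ((enorm (gf y w + gg y w) ^+ 2)%R%:E : \bar R).
have mN : measurable_fun setT N.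
  apply/measurable_EFinP; apply: measurable_enorm_sqr.
  by apply: measurable_addrV; exact: jointly_measurable_rV_section.
have gapE : gap y = (F y - F (xbar y))%E by rewrite /gap (optvalE y).
have gapf := gap_fin_num _ yF.
have NB : (\int[P]_w N w <= (B ^+ 2 + L * fine (gap y))%:E)%E.
  by rewrite EFinD (EFinM L) fineK // gapE; exact: bounded_gradient.
have N0 w : (0 <= N w)%E by rewrite lee_fin sqr_ge0.
have iN : P.-integrable setT N.
  apply/integrableP; split => //; under eq_integral do rewrite gee0_abs //.
  exact: le_lt_trans NB (ltry _).
have Nf : (\int[P]_w N w)%E \is a fin_num by exact: integrable_fin_num.
pose c := dist2 y + gamma ^+ 2 * C.
pose h w := ((f y w + g y w) - (f z w + g z w))%E.
have ih : P.-integrable setT h by apply: integrableB => //; exact: integrableD.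
have Eh : (\int[P]_w h w = gap y)%E.
  by rewrite /h integralB ?integralD ?gapE //; exact: integrableD.
pose U w := (c%:E + (gamma ^+ 2)%:E * N w - (2 * gamma)%:E * h w)%E.
have ic : P.-integrable setT (fun=> c%:E).
  exact: finite_measure_integrable_cst.
have iU1 : P.-integrable setT (fun w => c%:E + (gamma ^+ 2)%:E * N w)%E.
  by apply: integrableD => //; exact: integrableZl.
have iU2 : P.-integrable setT (fun w => (2 * gamma)%:E * h w)%E.
  exact: integrableZl.
have EU : (\int[P]_w U w = c%:E + (gamma ^+ 2)%:E * \int[P]_w N w -
    (2 * gamma)%:E * gap y)%E.
  rewrite /U integralB // integralD //; last exact: integrableZl.
  by rewrite !integralZl // Eh integral_cst //=
    (@probability_setT _ _ _ P) mule1.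
have le_U : (\int[P]_w (dist2 (Phi y w))%:E <= \int[P]_w U w)%E.
  apply: ae_ge0_le_integral_measurable.
  - exact: (measurable_fun_pair2 (y : borel_rV R m) measurable_dist2_step).
  - exact: (measurable_int P (integrableB measurableT iU1 iU2)).
  - by move=> w; rewrite lee_fin.
  have yfin : {ae P, forall w, f y w \is a fin_num /\ g y w \is a fin_num}.
    move: (integrable_ae measurableT fy) (integrable_ae measurableT gy).
    by apply: filterS2 => w /(_ I) ? /(_ I) ?.
  have zfin : {ae P, forall w, f z w \is a fin_num /\ g z w \is a fin_num}.
    move: (integrable_ae measurableT fz) (integrable_ae measurableT gz).
    by apply: filterS2 => w /(_ I) ? /(_ I) ?.
  have := Phi_step _ _ yF zF; move: yfin zfin; apply: filterS3 => w.
  move=> [/fineK fyE /fineK gyE] [/fineK fzE /fineK gzE] step.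
  rewrite /U /h /N -fzE -gzE -fyE -gyE -!(EFinM, EFinD, EFinB) lee_fin.
  have : dist2 (Phi y w) <= enorm (xbar y - Phi y w) ^+ 2.
    rewrite /dist2 enormB ler_sqr ?nnegrE ?enorm_ge0 //.
    by case: (xbar_proj (Phi y w)) => _; apply.
  by move: step; rewrite /c /dist2 (enormB y); lra.
apply: le_trans (leeD le_U (lexx _)) _; rewrite EU.
move: Nf gapf NB (gap_ge0 y) => /fineK <- /fineK <-.
move: (fine (integral _ _ _)) (fine (gap y)) => n e.
rewrite -!(EFinM, EFinD, EFinB) !lee_fin /c => nB e0.
have h1 : gamma ^+ 2 * n <= gamma ^+ 2 * (B ^+ 2 + L * e).
  by rewrite ler_pM2l // exprn_gt0.
(* Half of the decrease 2 gamma gap(y) pays for the gap in the gradient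
   bound. *)
have h2 : gamma * e * (gamma * L) <= gamma * e * 1.
  by rewrite ler_wpM2l // mulr_ge0 // ltW.
lra.
Qed.

Variables (t : nat) (X : {RV Pr >-> borel_rV R m}).
Hypothesis X_indep : indep_of_future xi t X.
Hypothesis X_dom : {ae Pr, forall s, edom F (X s)}.

Lemma expected_step :
  (\int[Pr]_s (dist2 (Phi (X s) (xi t s)))%:E +
    gamma%:E * \int[Pr]_s gap (X s) <=
   \int[Pr]_s (dist2 (X s))%:E + (gamma ^+ 2 * (B ^+ 2 + C))%:E)%E.
Proof.
pose H y := (\int[P]_w (dist2 (Phi y w))%:E)%E.
have mH : measurable_fun setT (H : borel_rV R m -> \bar R).
  apply: (measurable_fun_fubini_tonelli_F _ measurable_dist2_step).
  by move=> z; rewrite lee_fin.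
have H0 y : (0 <= H y)%E by apply: integral_ge0 => w _; rewrite lee_fin.
have mHX : measurable_fun setT (fun s => H (X s)).
  exact: (measurableT_comp mH).
have mgX : measurable_fun setT (fun s => gap (X s)).
  exact: (measurableT_comp measurable_gap).
have mdX : measurable_fun setT (fun s => (dist2 (X s))%:E).
  by apply/measurable_EFinP; exact: (measurableT_comp measurable_dist2).
have C0 : 0 <= gamma ^+ 2 * (B ^+ 2 + C) by rewrite mulr_ge0 ?addr_ge0 ?sqr_ge0.
have g0 : (0 <= gamma%:E)%E by rewrite lee_fin ltW.
have -> := integral_current_sample xi xi_iid t X X_indep _
  measurable_dist2_step (fun=> dist2_ge0 _).
rewrite -ge0_integralZl // -ge0_integralD //; last 3 first.
- by move=> s _; exact: H0.
- by move=> s _; rewrite mule_ge0.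
- exact: emeasurable_funM.
apply: (@le_trans _ _ (\int[Pr]_s
    ((dist2 (X s))%:E + (gamma ^+ 2 * (B ^+ 2 + C))%:E))%E).
  apply: ae_ge0_le_integral_measurable.
  - by apply: emeasurable_funD => //; exact: emeasurable_funM.
  - exact: emeasurable_funD.
  - by move=> s; apply: adde_ge0; [exact: H0|exact: mule_ge0].
  apply: filterS X_dom => s sF; rewrite -EFinD; exact: expected_descent.
rewrite ge0_integralD //.
  by rewrite integral_cst //= (@probability_setT _ _ _ Pr) mule1.
by move=> s _; rewrite lee_fin.
Qed.

End one_step.

Section iterates.
Variables (gamma : nat -> R) (Phi : nat -> 'rV[R]_m -> Omega -> 'rV[R]_m).
Variables (x0 : 'rV[R]_m) (x : nat -> S -> 'rV[R]_m) (Rad : R).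
Hypothesis gamma_gt0 : forall t, 0 < gamma t.
Hypothesis gamma_nincr : forall t, gamma t.+1 <= gamma t.
Hypothesis gammaL : forall t, gamma t * L <= 1.
Hypothesis Phi_meas : forall t, jointly_measurable_rV (Phi t).
Hypothesis Phi_step : forall t, descent_step (gamma t) (Phi t).
Hypothesis x_0 : forall s, x 0%N s = x0.
Hypothesis x_S : forall t s, x t.+1 s = Phi t (x t s) (xi t s).
Hypothesis x_dom : forall t, {ae Pr, forall s, edom F (x t s)}.
Hypothesis x_bounded : forall t : nat,
  (\int[Pr]_s (enorm (x t s - xbar (x t s)) ^+ 2)%R%:E <= (Rad ^+ 2)%R%:E)%E.

(** Measurability and independence are proved together, since the independence
    step speaks of the law of x t. *)
Lemma iterate_indep t : measurable_fun setT (x t : S -> borel_rV R m) /\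
  indep_of_future xi t (x t : S -> borel_rV R m).
Proof.
elim: t => [|t [mx ix]].
  have -> : x 0%N = cst x0 by apply/funext.
  by split; [exact: measurable_cst|exact: indep_of_future_cst].
pose X : {RV Pr >-> borel_rV R m} := mfun_Sub (mem_set mx).
pose Psi (z : borel_rV R m * Omega) : borel_rV R m := Phi t z.1 z.2.
have -> : x t.+1 = Psi \o (fun s => (x t s, xi t s)).
  by apply/funext => s; rewrite /= x_S.
split.
  apply: (measurableT_comp (Phi_meas t)).
  by apply: measurable_fun_pair.
apply: indep_of_future_comp; first exact: Phi_meas.
exact: (indep_of_future_pair xi xi_iid t X ix).
Qed.

Let mdist2 t : measurable_fun setT (fun s => (dist2 (x t s))%:E).
Proof.
have [mx _] := iterate_indep t.
by apply/measurable_EFinP; exact: (measurableT_comp measurable_dist2 mx).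
Qed.

Let mgap t : measurable_fun setT (fun s => gap (x t s)).
Proof.
have [mx _] := iterate_indep t; exact: (measurableT_comp measurable_gap mx).
Qed.

Let a t : R := fine (\int[Pr]_s (dist2 (x t s))%:E).
Let e t : R := fine (\int[Pr]_s gap (x t s)).

Let aE t : (\int[Pr]_s (dist2 (x t s))%:E)%E = (a t)%:E.
Proof.
rewrite fineK // ge0_fin_numE; first exact: le_lt_trans (x_bounded t) (ltry _).
by apply: integral_ge0 => s _; rewrite lee_fin.
Qed.

Let step t : ((a t.+1)%:E + (gamma t)%:E * \int[Pr]_s gap (x t s) <=
  (a t + gamma t ^+ 2 * (B ^+ 2 + C))%:E)%E.
Proof.
have [mx ix] := iterate_indep t.
pose X : {RV Pr >-> borel_rV R m} := mfun_Sub (mem_set mx).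
rewrite EFinD -!aE; under eq_integral do rewrite x_S.
exact: (expected_step (gamma t) (Phi t) (gamma_gt0 t) (gammaL t) (Phi_meas t)
  (Phi_step t) t X ix (x_dom t)).
Qed.

Let eE t : (\int[Pr]_s gap (x t s))%E = (e t)%:E.
Proof.
have I0 : (0 <= \int[Pr]_s gap (x t s))%E by exact: integral_ge0.
rewrite fineK // ge0_fin_numE //; move: (step t) I0.
case: (integral _ _ _) => [r _ _| |] //; first exact: ltry.
by rewrite gt0_muley ?lte_fin // addey // leye_eq.
Qed.

(** The bound on the distances makes every expectation finite, which reduces
    the claim to a statement on real sequences. *)
Lemma gap_sum_bound t : (0 < t)%N ->
  (\sum_(0 <= j < t) \int[Pr]_s gap (x j s) <=
    (Rad ^+ 2 / gamma t.-1 + (B ^+ 2 + C) * \sum_(0 <= j < t) gamma j)%:E)%E.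
Proof.
move=> t0; under eq_bigr do rewrite eE; rewrite sumEFin lee_fin.
apply: (telescoping_bound a) => // j.
  rewrite -!lee_fin -aE x_bounded andbT.
  by apply: integral_ge0 => s _; rewrite lee_fin.
by rewrite -lee_fin EFinD (EFinM (gamma j)) -eE; exact: step.
Qed.

Lemma gap_average_bound t : (0 < t)%N ->
  (\int[Pr]_s gap (average x t s) <= (t%:R^-1 *
    (Rad ^+ 2 / gamma t.-1 + (B ^+ 2 + C) * \sum_(0 <= j < t) gamma j))%:E)%E.
Proof.
move=> t0; have it0 : 0 < t%:R^-1 :> R by rewrite invr_gt0 ltr0n.
rewrite EFinM; apply: (@le_trans _ _
    (t%:R^-1%:E * \sum_(0 <= j < t) \int[Pr]_s gap (x j s))%E); last first.
  by rewrite lee_pmul2l // gap_sum_bound.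
rewrite -ge0_integral_sum // -ge0_integralZl //; last 2 first.
- exact: emeasurable_sum.
- by move=> s _; exact: sume_ge0.
apply: ge0_le_integral => //.
- apply: (measurableT_comp measurable_gap); apply: measurable_scalerV.
  by apply: measurable_sumrV => j; have [] := iterate_indep j.
- by apply: emeasurable_funM => //; exact: emeasurable_sum.
- by move=> s _; exact: (econvex_average gap (fun j => x j s)).
Qed.

End iterates.

End splitting_method.

(** * The two methods and their convergence rate *)

Section methods.
Context {R : realType} {m : nat} {d : measure_display}.
Context {Omega : measurableType d} {P : probability Omega R}.
Variables (f g : 'rV[R]_m -> Omega -> \bar R).
Variables (gf gg : 'rV[R]_m -> Omega -> 'rV[R]_m).
Variables (proxf proxg : R -> 'rV[R]_m -> Omega -> 'rV[R]_m).
Local Notation F := (objective P f g).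
Hypothesis f_proper : forall w, proper_fun (f ^~ w).
Hypothesis g_proper : forall w, proper_fun (g ^~ w).
Hypothesis f_convex : forall w, econvex (f ^~ w).
Hypothesis g_convex : forall w, econvex (g ^~ w).
Hypothesis fg_finite : forall y, edom F y ->
  P.-integrable setT (f y) /\ P.-integrable setT (g y).
Hypothesis gf_oracle : subgradient_oracle P (edom F) f gf.
Hypothesis gg_oracle : subgradient_oracle P (edom F) g gg.
Hypothesis proxf_prox : prox_operator f proxf.
Hypothesis proxg_prox : prox_operator g proxg.

Let ae_fin_num y : edom F y ->
  {ae P, forall w, f y w \is a fin_num /\ g y w \is a fin_num}.
Proof.
move=> /fg_finite[fy gy].
move: (integrable_ae measurableT fy) (integrable_ae measurableT gy).
by apply: filterS2 => w /(_ I) ? /(_ I) ?.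
Qed.

Let ae_subdiff y : edom F y -> {ae P, forall w,
  subdiff (f ^~ w) y (gf y w) /\ subdiff (g ^~ w) y (gg y w)}.
Proof.
case: gf_oracle gg_oracle => [_ fs _ _] [_ gs _ _] yF.
by move: (fs y yF) (gs y yF); apply: filterS2.
Qed.

Lemma spg_descent gamma : 0 < gamma -> descent_step (P := P) f g gf gg 0 gamma
  (fun y w => proxg gamma (y - gamma *: gf y w) w).
Proof.
move=> gamma0 y z yF zF; have [gprox _] := proxg_prox _ gamma0.
move: (ae_fin_num _ yF) (ae_fin_num _ zF) (ae_subdiff _ yF).
apply: filterS3 => w [fy gy] [fz gz] [fs gs]; rewrite addr0.
have gp := gprox (y - gamma *: gf y w) w.
apply: (spg_step _ _ _ _ _ _ _ _ _ _ _ gamma0 (subdiff_fine _ _ _ _ fs fy fz)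
  (subdiff_fine _ _ _ _ gs gy _)).
  exact: prox_fin_num gp.
exact: prox_three_point gp gz.
Qed.

Lemma spp_descent Bg gamma : (forall y w, enorm (gg y w) <= Bg) ->
  0 < gamma -> descent_step (P := P) f g gf gg (Bg ^+ 2) gamma
    (fun y w => proxg gamma (proxf gamma y w) w).
Proof.
move=> ggB gamma0 y z yF zF.
have [fprox _] := proxf_prox _ gamma0; have [gprox _] := proxg_prox _ gamma0.
move: (ae_fin_num _ yF) (ae_fin_num _ zF) (ae_subdiff _ yF).
apply: filterS3 => w [fy gy] [fz gz] [fs gs].
have fp := fprox y w; have gp := gprox (proxf gamma y w) w.
apply: (spp_step _ _ _ _ _ _ _ _ _ _ _ _ _ _ gamma0 (ggB y w)
  (subdiff_fine _ _ _ _ fs fy _) (subdiff_fine _ _ _ _ gs gy _)).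
- exact: prox_fin_num fp.
- exact: prox_fin_num gp.
- exact: prox_three_point fp fz.
- exact: prox_three_point gp gz.
Qed.

End methods.

Lemma ae_exists (R : realType) (d : measure_display) (S : measurableType d)
    (Pr : probability S R) (Q : S -> Prop) :
  {ae Pr, forall s, Q s} -> exists s, Q s.
Proof.
have Pr0 : (0 < Pr setT)%E by rewrite probability_setT.
by have PF := ae_properfilter_algebraOfSetsType Pr0; move/(@filter_ex _ _ PF).
Qed.

Theorem theorem2p6 (R : realType) (m : nat)
    (d d' : measure_display)
    (Omega : measurableType d) (P : probability Omega R)
    (S : measurableType d') (Pr : probability S R)
    (xi : nat -> {RV Pr >-> Omega})
    (f g : 'rV[R]_m -> Omega -> \bar R)
    (gf gg : 'rV[R]_m -> Omega -> 'rV[R]_m)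
    (proxg : R -> 'rV[R]_m -> Omega -> 'rV[R]_m)
    (xbar : 'rV[R]_m -> 'rV[R]_m)
    (L B Rad : R) (gamma : nat -> R)
    (x0 : 'rV[R]_m) (x : nat -> S -> 'rV[R]_m)
    (F := objective P f g)
    (f_meas : jointly_measurable_ereal f)
    (g_meas : jointly_measurable_ereal g)
    (f_proper : forall w, proper_fun (f ^~ w))
    (g_proper : forall w, proper_fun (g ^~ w))
    (f_convex : forall w, econvex (f ^~ w))
    (g_convex : forall w, econvex (g ^~ w))
    (fg_finite : forall y, edom F y ->
       P.-integrable setT (f y) /\ P.-integrable setT (g y))
    (gf_oracle : subgradient_oracle P (edom F) f gf)
    (gg_oracle : subgradient_oracle P (edom F) g gg)
    (proxg_prox : prox_operator g proxg)
    (xbar_proj : forall y, eproj (argmin F) y (xbar y))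
    (L_gt0 : 0 < L) (B_ge0 : 0 <= B)
    (bounded_gradient : forall y, edom F y ->
       (\int[P]_w (enorm (gf y w + gg y w) ^+ 2)%R%:E <=
        (B ^+ 2)%R%:E + L%:E * (F y - F (xbar y)))%E)
    (gamma_0 : gamma 0%N = L^-1)
    (gamma_t : forall t : nat, (1 <= t)%N ->
       gamma t = gamma 0%N / Num.sqrt (t%:R : R))
    (xi_iid : iid_copies P xi)
    (x_dom : forall t, {ae Pr, forall s, edom F (x t s)})
    (x_bounded : forall t : nat,
       (\int[Pr]_s (enorm (x t s - xbar (x t s)) ^+ 2)%R%:E <= (Rad ^+ 2)%R%:E)%E) :
  (SPG_iterates xi gamma x0 gf proxg x ->
   forall t : nat, (1 <= t)%N ->
     (\int[Pr]_s (F (average x t s) - optval F) <=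
      ((Num.sqrt (t%:R : R))^-1 * (Rad ^+ 2 * L + 2 * B ^+ 2 / L))%R%:E)%E)
  /\
  (forall (proxf : R -> 'rV[R]_m -> Omega -> 'rV[R]_m) (Bg : R),
   prox_operator f proxf ->
   0 < Bg ->
   (forall y w, enorm (gg y w) <= Bg) ->
   SPP_iterates xi gamma x0 proxf proxg x ->
   forall t : nat, (1 <= t)%N ->
     (\int[Pr]_s (F (average x t s) - optval F) <=
      ((Num.sqrt (t%:R : R))^-1 *
        (Rad ^+ 2 * L + 2 * (B ^+ 2 + Bg ^+ 2) / L))%R%:E)%E).
Proof.
have F_dom : edom F !=set0.
  by have [s sF] := ae_exists _ _ _ _ _ (x_dom 0%N); exists (x 0%N s).
have [gf_meas _ _ _] := gf_oracle; have [gg_meas _ _ _] := gg_oracle.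
have g0 := step_size_gt0 L gamma L_gt0 gamma_0 gamma_t.
have rate (C : R) (Phi : nat -> 'rV[R]_m -> Omega -> 'rV[R]_m) : 0 <= C ->
  (forall t, jointly_measurable_rV (Phi t)) ->
  (forall t, descent_step (P := P) f g gf gg C (gamma t) (Phi t)) ->
  (forall s, x 0%N s = x0) ->
  (forall t s, x t.+1 s = Phi t (x t s) (xi t s)) ->
  forall t, (1 <= t)%N -> (\int[Pr]_s (F (average x t s) - optval F) <=
    ((Num.sqrt (t%:R : R))^-1 *
      (Rad ^+ 2 * L + 2 * (B ^+ 2 + C) / L))%R%:E)%E.
  move=> C0 mPhi sPhi xi0 xiS t t0.
  apply: le_trans (gap_average_bound xi xi_iid f g gf gg xbar f_meas g_meas
    f_convex g_convex fg_finite gf_meas gg_meas xbar_proj F_dom L B C C0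
    bounded_gradient gamma Phi x0 x Rad g0
    (step_size_nincr L gamma L_gt0 gamma_0 gamma_t)
    (step_size_le L gamma L_gt0 gamma_0 gamma_t) mPhi sPhi xi0 xiS x_dom
    x_bounded t t0) _.
  rewrite lee_fin; apply: step_size_rate => //; first exact: sqr_ge0.
  by rewrite addr_ge0 ?sqr_ge0.
split=> [[xi0 xiS]|proxf Bg proxf_prox Bg0 ggB [xi0 xiS]].
  have := rate 0 (fun t y w => proxg (gamma t) (y - gamma t *: gf y w) w).
  rewrite addr0; apply => // t.
    have [_ pm] := proxg_prox _ (g0 t).
    apply: (jointly_measurable_rV_comp (proxg (gamma t))
      (fun y w => y - gamma t *: gf y w) pm).
    rewrite /jointly_measurable_rV; under eq_fun do rewrite -scaleNr.
    apply: measurable_addrV; first exact: measurable_fst.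
    exact: measurable_scalerV.
  exact: spg_descent.
apply: (rate (Bg ^+ 2)
  (fun t y w => proxg (gamma t) (proxf (gamma t) y w) w)) => // [||t].
- exact: sqr_ge0.
- move=> t; have [_ pgm] := proxg_prox _ (g0 t).
  have [_ pfm] := proxf_prox _ (g0 t).
  exact: (jointly_measurable_rV_comp (proxg (gamma t)) (proxf (gamma t))).
- exact: (spp_descent f g gf gg proxf proxg).
Qed.
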